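(* Let $P$ be a logic program and $\tau^+$ be a set of positions with associated terms that is DN for $P$. Then the filter $\Delta[\tau^+]$ associated to $\tau^+$ is DN for $P$.
   Context: Fix a first-order language $\mathcal L$ with infinitely many constant symbols; $\Pi$ is its set of relation symbols, each $p$ with unique arity $arity(p)$; $TU_{\mathcal L}$ is the set of all terms; $[1,n]=\{1,\dots,n\}$. A query is a finite sequence of atoms; a logic program is a finite set of definite clauses. SLD-derivation step: given a query $\mathbf A,B,\mathbf C$ and a clause $c$, take a variant $H\leftarrow\mathbf B$ of $c$ variable disjoint from the query with $B,H$ unifiable and mgu $\theta$; then $\mathbf A,B,\mathbf C\Rightarrow_c^\theta(\mathbf A,\mathbf B,\mathbf C)\theta$ (selected atom $B$). A term-condition is a map $TU_{\mathcal L}\to\{\mathtt{true},\mathtt{false}\}$. A filter $\Delta$ assigns to each $p\in\Pi$ a partial function $\Delta(p)$ from $[1,arity(p)]$ to term-conditions. For a substitution $\eta$, an atom $A=p(s_1,\dots,s_n)$ is $\Delta$-more general than $B$ for $\eta$ if $B=p(t_1,\dots,t_n)$, $t_i=s_i\eta$ for $i\notin Dom(\Delta(p))$, and $\Delta(p)(i)(s_i)=\mathtt{true}$ for $i\in Dom(\Delta(p))$; a query $A_1,\dots,A_n$ is $\Delta$-more general than $B_1,\dots,B_m$ for $\eta$ if $n=m$ and componentwise for the same $\eta$; ''$\Delta$-more general'' means for some $\eta$. $Q'\Rightarrow_cQ'_1$ is a $\Delta$-lift of $Q\Rightarrow_cQ_1$ if $Q'$ is $\Delta$-more general than $Q$,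 $Q'_1$ is $\Delta$-more general than $Q_1$, and atoms in the same positions are selected in $Q$ and $Q'$. $\Delta$ is DN for a clause $c$ if for every step $Q\Rightarrow_cQ_1$ and every query $Q'$ $\Delta$-more general than $Q$ there is $Q'_1$ with $Q'\Rightarrow_cQ'_1$ a $\Delta$-lift of $Q\Rightarrow_cQ_1$; DN for $P$ if DN for each clause of $P$. A set of positions with associated terms $\tau^+$ assigns to each $p\in\Pi$ a partial function $\tau^+(p)$ from $[1,arity(p)]$ to $TU_{\mathcal L}$; write $\langle i\mapsto u\rangle\in\tau^+(p)$ if $i\in Dom(\tau^+(p))$ and $\tau^+(p)(i)=u$. Its associated filter $\Delta[\tau^+]$ maps each $p$ to the function with domain $Dom(\tau^+(p))$ sending $i$ to the term-condition $t\mapsto\mathtt{true}$ iff $t$ is an instance of $\tau^+(p)(i)$. $\tau^+$ is DN for a clause $p(s_1,\dots,s_n)\leftarrow\mathbf B$ if: (DN1) for all $i\in Dom(\tau^+(p))$ and $j\in[1,n]\setminus\{i\}$, $Var(s_i)\cap Var(s_j)=\emptyset$; (DN2) for all $\langle i\mapsto u_i\rangle\in\tau^+(p)$, $s_i$ is more general than $u_i$; (DN3) for all $i\in Dom(\tau^+(p))$, all atoms $q(t_1,\dots,t_m)$ in $\mathbf B$ and all $j\in[1,m]\setminus Dom(\tau^+(q))$, $Var(s_i)\cap Var(t_j)=\emptyset$; (DN4) for all atoms $q(t_1,\dots,t_m)$ in $\mathbf B$ and all $\langle j\mapsto u_j\rangle\in\tau^+(q)$, $t_j$ is an instance of $u_j$.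 $\tau^+$ is DN for a program if it is DN for each of its clauses. *)

(* Defs.v *)
From Stdlib Require List.
From mathcomp Require Import all_boot.
From mathcomp Require Import boolp classical_sets cardinality.

Set Implicit Arguments.
Unset Strict Implicit.
Unset Printing Implicit Defensive.

Local Open Scope classical_set_scope.

Record language := Language {
  fsym : Type;
  farity : fsym -> nat;
  rsym : Type;
  rarity : rsym -> nat;
  infinite_constants : infinite_set [set f | farity f = 0]
}.

(* Variables are the natural numbers, and positions [1, n] are 'I_n, i.e.
   numbered from 0. *)
Inductive term (L : language) :=
| Var of nat
| App (f : fsym L) of {ffun 'I_(farity f) -> term L}.

Arguments Var {L} _.
Arguments App {L} f _.

Section Syntax.
Variable L : language.

Record atom := Atom {
  atom_rel : rsym L;
  atom_args : {ffun 'I_(rarity atom_rel) -> term L}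
}.

Definition query := seq atom.

Record clause := Clause { clause_head : atom; clause_body : query }.

Fixpoint term_vars (t : term L) : set nat :=
  match t with
  | Var x => [set x]
  | App _ a => [set x | exists i, term_vars (a i) x]
  end.

Definition atom_vars (A : atom) : set nat :=
  [set x | exists i, term_vars (atom_args A i) x].

Definition query_vars (Q : query) : set nat :=
  [set x | exists2 A, List.In A Q & atom_vars A x].

Definition clause_vars (c : clause) : set nat :=
  atom_vars (clause_head c) `|` query_vars (clause_body c).

Record substitution := Subst {
  subst_fun :> nat -> term L;
  subst_finite : finite_set [set x | subst_fun x <> Var x]
}.

Fixpoint term_subst (s : nat -> term L) (t : term L) : term L :=
  match t with
  | Var x => s x
  | App f a => App f [ffun i => term_subst s (a i)]
  end.

Definition atom_subst (s : substitution) (A : atom) : atom :=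
  Atom [ffun i => term_subst s (atom_args A i)].

Definition query_subst (s : substitution) (Q : query) : query := map (atom_subst s) Q.

Definition clause_subst (s : substitution) (c : clause) : clause :=
  Clause (atom_subst s (clause_head c)) (query_subst s (clause_body c)).

Definition instance_of (t u : term L) : Prop :=
  exists s : substitution, t = term_subst s u.

Definition more_general (t u : term L) : Prop := instance_of u t.

(* The domain being finite, this says that r permutes its domain. *)
Definition renaming (r : substitution) : Prop :=
  exists2 f : nat -> nat, bijective f & forall x, r x = Var (f x).

Definition variant (c' c : clause) : Prop :=
  exists2 r : substitution, renaming r & c' = clause_subst r c.

Definition unifier (s : substitution) (A B : atom) : Prop :=
  atom_subst s A = atom_subst s B.

Definition mgu (s : substitution) (A B : atom) : Prop :=
  unifier s A B /\
  forall s' : substitution, unifier s' A B ->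
    exists g : substitution, forall x, s' x = term_subst g (s x).

(* k is the position, from 0, of the selected atom. *)
Definition sld_step_mgu (c : clause) (theta : substitution) (k : nat)
    (Q Q1 : query) : Prop :=
  exists (A : query) (B : atom) (C : query) (c' : clause),
    [/\ Q = A ++ B :: C /\ size A = k,
        variant c' c,
        clause_vars c' `&` query_vars Q = set0,
        mgu theta B (clause_head c')
      & Q1 = query_subst theta (A ++ clause_body c' ++ C)].

Definition sld_step (c : clause) (k : nat) (Q Q1 : query) : Prop :=
  exists theta, sld_step_mgu c theta k Q Q1.

Definition program := set clause.

End Syntax.

Definition pfun_dom (I T : Type) (f : I -> option T) : set I :=
  [set i | exists x, f i = Some x].

Section Filters.
Variable L : language.

Definition term_condition := term L -> bool.

Definition atom_filter := forall p : rsym L, 'I_(rarity p) -> option term_condition.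

(* dmg: D-more general, the first atom or query being the more general one. *)
Definition atom_dmg (D : atom_filter) (eta : substitution L) (A B : atom L) : Prop :=
  exists (p : rsym L) (s t : {ffun 'I_(rarity p) -> term L}),
    [/\ A = Atom s,
        B = Atom t,
        forall i, ~ pfun_dom (D p) i -> t i = term_subst eta (s i)
      & forall i b, D p i = Some b -> b (s i) = true].

Definition query_dmg_for (D : atom_filter) (eta : substitution L) (Q' Q : query L) : Prop :=
  List.Forall2 (atom_dmg D eta) Q' Q.

Definition query_dmg (D : atom_filter) (Q' Q : query L) : Prop :=
  exists eta, query_dmg_for D eta Q' Q.

Definition is_lift (D : atom_filter) (c : clause L)
    (k' : nat) (Q' Q1' : query L) (k : nat) (Q Q1 : query L) : Prop :=
  [/\ sld_step c k' Q' Q1' /\ sld_step c k Q Q1,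
      query_dmg D Q' Q,
      query_dmg D Q1' Q1
    & k' = k].

Definition filter_DN_clause (D : atom_filter) (c : clause L) : Prop :=
  forall (k : nat) (Q Q1 : query L), sld_step c k Q Q1 ->
  forall Q' : query L, query_dmg D Q' Q ->
  exists (k' : nat) (Q1' : query L), is_lift D c k' Q' Q1' k Q Q1.

Definition filter_DN (D : atom_filter) (P : program L) : Prop :=
  forall c, P c -> filter_DN_clause D c.

Definition positions_terms :=
  forall p : rsym L, 'I_(rarity p) -> option (term L).

Definition assoc_filter (tau : positions_terms) : atom_filter :=
  fun p i => omap (fun u t => `[< instance_of t u >]) (tau p i).

Definition DN1 (tau : positions_terms) (c : clause L) : Prop :=
  let H := clause_head c in
  forall i j, pfun_dom (tau (atom_rel H)) i -> j <> i ->
    term_vars (atom_args H i) `&` term_vars (atom_args H j) = set0.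

Definition DN2 (tau : positions_terms) (c : clause L) : Prop :=
  let H := clause_head c in
  forall i u, tau (atom_rel H) i = Some u -> more_general (atom_args H i) u.

Definition DN3 (tau : positions_terms) (c : clause L) : Prop :=
  let H := clause_head c in
  forall i, pfun_dom (tau (atom_rel H)) i ->
  forall A, List.In A (clause_body c) ->
  forall j, ~ pfun_dom (tau (atom_rel A)) j ->
    term_vars (atom_args H i) `&` term_vars (atom_args A j) = set0.

Definition DN4 (tau : positions_terms) (c : clause L) : Prop :=
  forall A, List.In A (clause_body c) ->
  forall j u, tau (atom_rel A) j = Some u -> instance_of (atom_args A j) u.

Definition positions_DN_clause (tau : positions_terms) (c : clause L) : Prop :=
  [/\ DN1 tau c, DN2 tau c, DN3 tau c & DN4 tau c].

Definition positions_DN (tau : positions_terms) (P : program L) : Prop :=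
  forall c, P c -> positions_DN_clause tau c.

End Filters.

(* Main.v *)
Require Import Defs.
From mathcomp Require Import all_boot.
From mathcomp Require Import boolp classical_sets cardinality.

(** Rename the clause [c] apart from the lifted query [Q'].  With [theta] the mgu
    of the given step and [eta] the substitution witnessing that [Q'] is more
    general, let [sigma] be [eta theta] on the variables of [Q'], the composite
    of [eta theta] with a matcher of the [i]-th head argument onto the [i]-th
    argument of the selected atom of [Q'] on the variables of that head argument
    when [i] is a position of [tau] (a matcher exists by DN2, and the choice of
    [i] is unambiguous by DN1), and [theta] on the remaining renamed variables.
    Then [sigma] unifies the new selected atom with the renamed head, so it
    factors through an mgu [theta'], and the factor witnesses that the new
    resolvent is more general: DN3 makes [sigma] agree with [theta] on the body
    positions outside [tau], and DN4 takes care of the others. *)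

Set Implicit Arguments.
Unset Strict Implicit.
Unset Printing Implicit Defensive.

Local Open Scope classical_set_scope.

(** Proof irrelevance collapses the equality of indices to [erefl]; this allows symbol types without
    decidable equality. *)
Lemma existT_inj2 (I : Type) (T : I -> Type) (i : I) (x y : T i) :
  existT T i x = existT T i y -> x = y.
Proof.
move=> e; have := projT2_eq e.
by rewrite (Prop_irrelevance (projT1_eq e) erefl).
Qed.

Lemma mem_In (T : eqType) (x : T) (s : seq T) : x \in s -> List.In x s.
Proof.
elim: s => // y s IHs; rewrite inE => /orP[/eqP->|/IHs]; [by left|by right].
Qed.

(** * Substitutions, instances and bounds on variables *)

Section Substitutions.
Variable L : language.
Implicit Types (t u : term L) (A B : atom L) (Q : query L) (f g : nat -> term L).

(** Structural induction that reaches the subterms stored as values of a finite function. *)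
Lemma term_nested_ind (P : term L -> Prop) :
  (forall x, P (Var x)) ->
  (forall h (a : {ffun 'I_(farity h) -> term L}), (forall i, P (a i)) -> P (App h a)) ->
  forall t, P t.
Proof.
move=> PV PA; fix IH 1 => -[x|h a]; first exact: PV.
by apply: PA => i; exact: IH.
Qed.

Lemma App_inj h (a b : {ffun 'I_(farity h) -> term L}) : App h a = App h b -> a = b.
Proof. by case=> e; exact: existT_inj2 e. Qed.

Lemma Atom_inj p (a b : {ffun 'I_(rarity p) -> term L}) : Atom a = Atom b -> a = b.
Proof. by case=> e; exact: existT_inj2 e. Qed.

Lemma eq_in_term_subst f g t :
  (forall x, term_vars t x -> f x = g x) -> term_subst f t = term_subst g t.
Proof.
elim/term_nested_ind: t => [x|h a IH] /= fg; first exact: fg.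
congr App; apply/ffunP => i; rewrite !ffunE; apply: IH => x xi.
by apply: fg; exists i.
Qed.

Lemma eq_term_subst f g t : f =1 g -> term_subst f t = term_subst g t.
Proof. by move=> fg; apply: eq_in_term_subst. Qed.

Lemma term_subst_comp f g t :
  term_subst g (term_subst f t) = term_subst (fun x => term_subst g (f x)) t.
Proof.
elim/term_nested_ind: t => [//|h a IH] /=.
by congr App; apply/ffunP => i; rewrite !ffunE.
Qed.

Lemma bounded_finite_support f N :
  (forall x, (N <= x)%N -> f x = Var x) -> finite_set [set x | f x <> Var x].
Proof.
move=> fN; apply: (sub_finite_set _ (finite_II N)) => x /= fx.
by rewrite ltnNge; apply/negP => /fN.
Qed.

Definition id_subst : substitution L :=
  Subst (@bounded_finite_support Var 0 (fun _ _ => erefl)).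

(** A variable moved by the composite but fixed by [s] is moved by [s'], so the support lies in the
    union of both supports. *)
Lemma comp_finite_support (s s' : substitution L) :
  finite_set [set x | term_subst s' (s x) <> Var x].
Proof.
apply: (sub_finite_set _ (_ : finite_set
  ([set x | s x <> Var x] `|` [set x | s' x <> Var x]))).
  move=> x /= sx; have [e|] := pselect (s x = Var x); last by left.
  by right; rewrite e in sx.
by rewrite finite_setU; split; exact: subst_finite.
Qed.

Definition comp_subst (s s' : substitution L) : substitution L :=
  Subst (comp_finite_support s s').

Lemma term_subst_comp_subst (s s' : substitution L) t :
  term_subst (comp_subst s s') t = term_subst s' (term_subst s t).
Proof. by rewrite term_subst_comp. Qed.

Lemma single_finite_support x t :
  finite_set [set y | (if y == x then t else Var y) <> Var y].
Proof.
apply: (@bounded_finite_support _ x.+1) => y xy.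
by case: eqP => // yx; rewrite yx ltnn in xy.
Qed.

Definition single_subst x t : substitution L := Subst (single_finite_support x t).

Lemma instance_of_subst (s : substitution L) t u :
  instance_of t u -> instance_of (term_subst s t) u.
Proof.
by case=> s' ->; exists (comp_subst s' s); rewrite term_subst_comp_subst.
Qed.

Lemma instance_of_trans t u v : instance_of t u -> instance_of u v -> instance_of t v.
Proof. by case=> s -> uv; apply: instance_of_subst. Qed.

(** This bound and its analogues below serve to rename a clause apart by moving its variables above
    a common bound. *)
Lemma term_vars_bounded t : exists N, forall x, term_vars t x -> (x < N)%N.
Proof.
elim/term_nested_ind: t => [x|h a IH] /=; first by exists x.+1 => _ ->.
have [N HN] := choice IH.
exists (\max_i N i) => x [i xi]; apply: leq_trans (HN _ _ xi) _.
exact: leq_bigmax.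
Qed.

Lemma atom_vars_bounded A : exists N, forall x, atom_vars A x -> (x < N)%N.
Proof.
have [N HN] := choice (fun i => term_vars_bounded (atom_args A i)).
exists (\max_i N i) => x [i xi]; apply: leq_trans (HN _ _ xi) _.
exact: leq_bigmax.
Qed.

Lemma query_vars_bounded Q : exists N, forall x, query_vars Q x -> (x < N)%N.
Proof.
elim: Q => [|A Q [N HN]]; first by exists 0 => x [].
have [M HM] := atom_vars_bounded A; exists (maxn M N) => x [B BQ xB].
rewrite leq_max; case: BQ => [AB|BQ].
  by rewrite HM ?AB.
by rewrite HN ?orbT //; exists B.
Qed.

Lemma clause_vars_bounded (c : clause L) :
  exists N, forall x, clause_vars c x -> (x < N)%N.
Proof.
have [M HM] := atom_vars_bounded (clause_head c).
have [N HN] := query_vars_bounded (clause_body c).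
by exists (maxn M N) => x [/HM|/HN] H; rewrite leq_max H ?orbT.
Qed.

Lemma term_vars_subst f t y :
  term_vars (term_subst f t) y -> exists2 x, term_vars t x & term_vars (f x) y.
Proof.
elim/term_nested_ind: t => [x|h a IH] /=; first by exists x.
by case=> i; rewrite ffunE => /IH[x xi yx]; exists x => //; exists i.
Qed.

Lemma atom_vars_subst (s : substitution L) A y :
  atom_vars (atom_subst s A) y -> exists2 x, atom_vars A x & term_vars (s x) y.
Proof.
by case=> i /=; rewrite ffunE => /term_vars_subst[x xi yx]; exists x => //; exists i.
Qed.

Lemma clause_vars_subst (s : substitution L) (c : clause L) y :
  clause_vars (clause_subst s c) y ->
  exists2 x, clause_vars c x & term_vars (s x) y.
Proof.
case=> [/atom_vars_subst[x xc yx]|[A]]; first by exists x => //; left.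
move/List.in_map_iff => [B [<- Bc]] /atom_vars_subst[x xB yx].
by exists x => //; right; exists B.
Qed.

End Substitutions.

(** * Existence of most general unifiers *)

Section Unification.
Variable L : language.
Implicit Types (t u : term L) (f g : nat -> term L) (E : seq (term L * term L)).

Fixpoint term_size t : nat :=
  match t with
  | Var _ => 1
  | App _ a => (\sum_i term_size (a i)).+1
  end.

Lemma term_size_gt0 t : (0 < term_size t)%N.
Proof. by case: t. Qed.

Lemma term_size_subst_var f t x :
  term_vars t x -> (term_size (f x) <= term_size (term_subst f t))%N.
Proof.
elim/term_nested_ind: t => [_ -> //|h a IH] /= [i xi].
apply/leqW/(leq_trans (IH i xi)).
by rewrite (bigD1 i) //= ffunE leq_addr.
Qed.

(** If [t] were a compound term containing [x], then [f x] would be a proper subterm of itself. *)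
Lemma occurs_check f t x : f x = term_subst f t -> term_vars t x -> t = Var x.
Proof.
case: t => [y _ -> //|h a] e [i xi].
suff : (term_size (f x) < term_size (f x))%N by rewrite ltnn.
rewrite {2}e /= ltnS; apply: leq_trans (term_size_subst_var f xi) _.
by rewrite (bigD1 i) //= ffunE leq_addr.
Qed.

(** Arbitrary maps are allowed, so that composites need no proof of finite support. *)
Definition unifies f E : Prop :=
  forall e, List.In e E -> term_subst f e.1 = term_subst f e.2.

Lemma unifies_cons f e E :
  unifies f (e :: E) <-> term_subst f e.1 = term_subst f e.2 /\ unifies f E.
Proof.
split=> [H|[He HE] e' [<- //|/HE //]].
by split=> [|e' He']; apply: H; [left|right].
Qed.

Lemma unifies_cat f E E' : unifies f (E ++ E') <-> unifies f E /\ unifies f E'.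
Proof.
elim: E => [|e E IH] /=; first by split=> [H|[_ //]]; split=> // e [].
by rewrite !unifies_cons IH and_assoc.
Qed.

Lemma unifies_enum f n (a b : 'I_n -> term L) :
  unifies f [seq (a i, b i) | i <- enum 'I_n] <->
  forall i, term_subst f (a i) = term_subst f (b i).
Proof.
split=> [H i|H e /List.in_map_iff[i [<- _]]]; last exact: H.
by apply: (H (a i, b i)); apply/List.in_map_iff; exists i; split=> //; exact/mem_In/mem_enum.
Qed.

Definition subst_pair f (e : term L * term L) := (term_subst f e.1, term_subst f e.2).

Lemma unifies_map f g E :
  unifies f (map (subst_pair g) E) <-> unifies (fun x => term_subst f (g x)) E.
Proof.
elim: E => [|e E IH] /=; first by split=> _ e [].
by rewrite !unifies_cons IH /= !term_subst_comp.
Qed.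

Lemma eq_unifies f g E : f =1 g -> unifies f E -> unifies g E.
Proof. by move=> /funext->. Qed.

(* Phrasing generality as [f = theta f] (so that [theta] is idempotent) keeps
   the composition of two such substitutions manageable. *)
Definition solution (theta : substitution L) E : Prop :=
  unifies theta E /\
  forall f, unifies f E -> forall x, f x = term_subst f (theta x).

Lemma solution_eq_unifies theta E E' :
  (forall f, unifies f E <-> unifies f E') -> solution theta E -> solution theta E'.
Proof. by move=> EE' [H1 H2]; split; [exact/EE'|move=> f /EE' /H2]. Qed.

Lemma single_substK f x t y :
  f x = term_subst f t -> f y = term_subst f (single_subst x t y).
Proof. by move=> e /=; case: eqP => [->|]. Qed.

(** A unifier of the full system absorbs the replacement of [x] by [t], hence unifies the reduced
    system and absorbs [theta] too; chaining both absorptions gives generality. *)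
Lemma solution_elim x t E theta : ~ term_vars t x ->
  solution theta (map (subst_pair (single_subst x t)) E) ->
  solution (comp_subst (single_subst x t) theta) ((Var x, t) :: E).
Proof.
move=> xt [U G]; split=> [|f /unifies_cons[/= e fE] y].
  apply/unifies_cons; split; last exact/unifies_map.
  rewrite /= eqxx; apply: eq_in_term_subst => y yt /=.
  by case: eqP => // yx; rewrite yx in yt.
have fy z : f z = term_subst f (single_subst x t z) by exact: single_substK.
rewrite /= term_subst_comp [LHS]fy; apply: eq_in_term_subst => z _.
by apply: G; apply/unifies_map; exact: eq_unifies fE.
Qed.

(* The size of the equations after applying a fixed unifier is invariant under
   the elimination of a variable, so it serves as termination measure. *)
Lemma unifiable_solution f E : unifies f E -> exists theta, solution theta E.
Proof.
have [n] := ubnP (\sum_(e <- E) term_size (term_subst f e.1)).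
elim: n E => // n IHn [_ _|[t u] E].
  exists (id_subst L); split=> [e []|g _ x]; exact: erefl.
rewrite big_cons /= ltnS => le_n /unifies_cons[/= e fE].
have lt_E : (\sum_(e <- E) term_size (term_subst f e.1) < n)%N.
  apply: leq_trans le_n; rewrite -[X in (X < _)%N]add0n ltn_add2r.
  exact: term_size_gt0.
(* Stated apart because it serves equations with the variable on either side. *)
have elim_var x v : f x = term_subst f v ->
    exists theta, solution theta ((Var x, v) :: E).
  move=> ev; have [->|vx] := pselect (v = Var x).
    have [theta H] := IHn _ lt_E fE; exists theta.
    by apply: solution_eq_unifies H => g; rewrite unifies_cons; split=> [|[]].
  have xv : ~ term_vars v x by move/(occurs_check ev).
  have [||theta H] := IHn (map (subst_pair (single_subst x v)) E).
  - rewrite big_map; apply: leq_ltn_trans lt_E; apply: eq_leq; apply: eq_bigr => e' _.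
    rewrite /= term_subst_comp; congr term_size; apply: eq_term_subst => y.
    by rewrite -single_substK.
  - by apply/unifies_map; apply: eq_unifies fE => y; exact: single_substK.
  by exists (comp_subst (single_subst x v) theta); exact: solution_elim.
case: t e le_n => [x|h a] e le_n; first exact: elim_var.
case: u e => [x|h' b] e.
  have [theta H] := elim_var x (App h a) (esym e); exists theta.
  by apply: solution_eq_unifies H => g; rewrite !unifies_cons /=; split=> -[->].
have hh' : h = h' by case: e.
case: h' / hh' b e => b /App_inj /ffunP e.
(* Decomposition into the equations between arguments lowers the measure by one, the contribution of
   the head symbol. *)
have [||theta H] := IHn ([seq (a i, b i) | i <- enum 'I_(farity h)] ++ E).
- apply: leq_trans le_n; rewrite big_cat big_map big_enum /= ltn_add2r ltnS.
  by apply: eq_leq; apply: eq_bigr => i _; rewrite ffunE.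
- apply/unifies_cat; split=> //; apply/unifies_enum => i.
  by have := e i; rewrite !ffunE.
exists theta; apply: solution_eq_unifies H => g.
rewrite unifies_cat unifies_cons unifies_enum /=; split=> -[H HE]; split=> //.
  by congr App; apply/ffunP => i; rewrite !ffunE.
by move=> i; move/App_inj/ffunP/(_ i): H; rewrite !ffunE.
Qed.

Lemma unifier_AtomP p (a b : {ffun 'I_(rarity p) -> term L}) (s : substitution L) :
  unifier s (Atom a) (Atom b) <-> forall i, term_subst s (a i) = term_subst s (b i).
Proof.
split=> [/Atom_inj/ffunP H i|H]; first by have := H i; rewrite !ffunE.
by rewrite /unifier /atom_subst /=; congr Atom; apply/ffunP => i; rewrite !ffunE.
Qed.

Lemma unifiable_mgu (A B : atom L) (s : substitution L) :
  unifier s A B -> exists theta, mgu theta A B.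
Proof.
case: A B => [p a] [q b] sAB; have pq : p = q by case: sAB.
case: q / pq b sAB => b /unifier_AtomP/unifies_enum/unifiable_solution[theta [U G]].
exists theta; split; first exact/unifier_AtomP/unifies_enum.
(* Since [s'] absorbs [theta], it is its own factor. *)
by move=> s' /unifier_AtomP/unifies_enum/G Gs'; exists s'.
Qed.

End Unification.

(** * Lifting of an SLD step *)

Section Lifting.
Variable L : language.

(** A shift by positive [N] is neither onto nor of finite support. Exchanging the blocks [0, N) and
    [N, 2N) yields a genuine renaming that acts as the shift below [N]. *)
Definition swap_blocks N x : nat :=
  if x < N then x + N else if x < N + N then x - N else x.

Lemma swap_blocksK N : involutive (swap_blocks N).
Proof.
move=> x; rewrite /swap_blocks; have [xN|Nx] := ltnP x N.
  by rewrite ltnNge leq_addl /= ltn_add2r xN addnK.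
have [xN|NNx] := ltnP x (N + N); first by rewrite ltn_subLR // xN subnK.
by rewrite ltnNge Nx /= ltnNge NNx.
Qed.

Lemma swap_blocks_finite_support N :
  finite_set [set x | Var (swap_blocks N x) <> Var x :> term L].
Proof.
apply: (@bounded_finite_support _ _ (N + N)) => x NNx.
by rewrite /swap_blocks ltnNge (leq_trans (leq_addl _ _) NNx) /= ltnNge NNx.
Qed.

Definition swap_subst N : substitution L := Subst (swap_blocks_finite_support N).

Lemma renaming_swap_subst N : renaming (swap_subst N).
Proof. by exists (swap_blocks N) => //; exists (swap_blocks N); exact: swap_blocksK. Qed.

Lemma pfun_dom_assoc_filter (tau : positions_terms L) p i :
  pfun_dom (@assoc_filter L tau p) i <-> pfun_dom (tau p) i.
Proof.
rewrite /pfun_dom /assoc_filter /=; case: (tau p i) => [u|] /=.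
  by split=> _; [exists u|eexists].
by split=> -[].
Qed.

Lemma assoc_filterP (tau : positions_terms L) p i (t : term L) :
  (forall b, @assoc_filter L tau p i = Some b -> b t = true) <->
  (forall u, tau p i = Some u -> instance_of t u).
Proof.
rewrite /assoc_filter; case: (tau p i) => [u|] //=; split=> H; last first.
  by move=> _ [<-]; apply/asboolP; exact: H.
by move=> _ [<-]; apply/asboolP; exact: (H _ erefl).
Qed.

Lemma atom_dmg_assocP (tau : positions_terms L) (eta : substitution L) p
    (a b : {ffun 'I_(rarity p) -> term L}) :
  (forall i, ~ pfun_dom (tau p) i -> b i = term_subst eta (a i)) ->
  (forall i u, tau p i = Some u -> instance_of (a i) u) ->
  atom_dmg (assoc_filter tau) eta (Atom a) (Atom b).
Proof.
move=> H1 H2; exists p, a, b; split=> // i; last exact/assoc_filterP/H2.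
by move=> /pfun_dom_assoc_filter; exact: H1.
Qed.

(** Query variables lie below [N] and renamed clause variables in [N, 2N), so [sigma] can be
    prescribed block by block. Its first two properties later transfer to the resolvent. *)
Lemma lift_unifier (tau : positions_terms L) (p : rsym L)
    (h s t : {ffun 'I_(rarity p) -> term L}) (body : query L)
    (eta theta r : substitution L) N :
  let c := Clause (Atom h) body in
  positions_DN_clause tau c ->
  (forall x, clause_vars c x -> (x < N)%N) ->
  (forall i x, term_vars (s i) x -> (x < N)%N) ->
  atom_dmg (assoc_filter tau) eta (Atom s) (Atom t) ->
  unifier theta (Atom t) (atom_subst r (Atom h)) ->
  exists sigma : substitution L,
    [/\ forall x, (x < N)%N -> sigma x = term_subst theta (eta x),
        forall x, (x < N)%N ->
          (forall i, pfun_dom (tau p) i -> ~ term_vars (h i) x) ->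
          sigma (x + N)%N = term_subst theta (r x)
      & unifier sigma (Atom s) (atom_subst (swap_subst N) (Atom h))].
Proof.
move=> c [dn1 dn2 dn3 dn4] cN sN dmg /unifier_AtomP U.
have hN i x : term_vars (h i) x -> (x < N)%N by move=> hx; apply: cN; left; exists i.
have [st tau_s] : (forall i, ~ pfun_dom (tau p) i -> t i = term_subst eta (s i)) /\
    (forall i u, tau p i = Some u -> instance_of (s i) u).
  case: dmg => q [a [b [sa tb ab ta]]].
  have pq : p = q by case: sa.
  case: q / pq a b sa tb ab ta => a b /Atom_inj -> /Atom_inj -> ab ta.
  split=> i; last exact/assoc_filterP/ta.
  by move=> pi; apply: ab => /pfun_dom_assoc_filter.
(* The matchers: by the filter [s i] is an instance of the term at [i], itself an instance of [h i]
   by DN2. The identity is a default elsewhere. *)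
have /choice[m mP] (i : 'I_(rarity p)) :
    exists m : substitution L, pfun_dom (tau p) i -> s i = term_subst m (h i).
  have [[u tu]|ntau] := pselect (pfun_dom (tau p) i); last by exists (id_subst L).
  have [m sm] : instance_of (s i) (h i).
    exact: instance_of_trans (tau_s _ _ tu) (dn2 _ _ tu).
  by exists m.
(* [w x] is the value intended for the renamed copy of [x]; DN1 makes it independent of the position
   [i]. *)
have /choice[w wP] (x : nat) : exists v : term L,
    (forall i, pfun_dom (tau p) i -> term_vars (h i) x ->
       v = term_subst theta (term_subst eta (m i x))) /\
    ((forall i, pfun_dom (tau p) i -> ~ term_vars (h i) x) ->
       v = term_subst theta (r x)).
  have [[i ti hx]|H] := pselect (exists2 i, pfun_dom (tau p) i & term_vars (h i) x).
    exists (term_subst theta (term_subst eta (m i x))); split; last by move/(_ _ ti).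
    move=> j tj hjx; have [-> //|ji] := pselect (j = i).
    by have /seteqP[/(_ x)[]] := dn1 _ _ ti ji.
  exists (term_subst theta (r x)); split=> // i ti hx.
  by case: H; exists i.
(* Fixing all variables from 2N on keeps the support finite. *)
pose f x := if x < N then term_subst theta (eta x)
            else if x < N + N then w (x - N) else Var x.
have f_fin : finite_set [set x | f x <> Var x].
  apply: (@bounded_finite_support _ _ (N + N)) => x NNx.
  by rewrite /f ltnNge (leq_trans (leq_addl _ _) NNx) /= ltnNge NNx.
have f_shift x : (x < N)%N -> f (x + N)%N = w x.
  by move=> xN; rewrite /f ltnNge leq_addl /= ltn_add2r xN addnK.
have f_low x : (x < N)%N -> f x = term_subst theta (eta x) by rewrite /f => ->.
exists (Subst f_fin); split=> [||].
- exact: f_low.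
- by move=> x xN nx; rewrite /= f_shift //; apply: (proj2 (wP x)).
apply/unifier_AtomP => i; rewrite ffunE /= term_subst_comp /=.
have -> : term_subst f (s i) = term_subst theta (term_subst eta (s i)).
  by rewrite term_subst_comp; apply: eq_in_term_subst => x /sN; exact: f_low.
have fh x : term_vars (h i) x -> f (swap_blocks N x) = w x.
  by move=> /hN xN; rewrite /swap_blocks xN f_shift.
rewrite (eq_in_term_subst fh).
(* At a position of [tau], both sides are [h i] under [m i], [eta] and [theta] in turn. *)
have [ti|nti] := pselect (pfun_dom (tau p) i).
  rewrite mP // !term_subst_comp; apply: eq_in_term_subst => x hx.
  by rewrite (proj1 (wP x) i) // term_subst_comp.
(* Elsewhere the given unifier applies, and by DN1 no variable of [h i] occurs in a head argument at
   a position of [tau]. *)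
rewrite -st // U ffunE term_subst_comp; apply: eq_in_term_subst => x hx.
apply/esym/(proj2 (wP x)) => j tj hjx.
have ij : i <> j by move=> ij; rewrite ij in nti.
by have /seteqP[/(_ x)[]] := dn1 _ _ tj ij.
Qed.

(** This handles the unselected atoms: [g] after [theta'] agrees with [theta] after [eta] on their
    variables, and instances are stable under substitution. *)
Lemma query_dmg_subst (tau : positions_terms L) (eta theta theta' g : substitution L)
    N (Q' Q : query L) :
  (forall x, query_vars Q' x -> (x < N)%N) ->
  (forall x, (x < N)%N -> term_subst g (theta' x) = term_subst theta (eta x)) ->
  query_dmg_for (assoc_filter tau) eta Q' Q ->
  query_dmg_for (assoc_filter tau) g (query_subst theta' Q') (query_subst theta Q).
Proof.
move=> QN gN QQ; elim: QQ QN => [|A' A Q0' Q0 AA _ IH] QN; first by constructor.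
constructor; last by apply: IH => x [B BQ xB]; apply: QN; exists B => //; right.
case: AA QN => q [a [b [-> -> ab ta]]] QN; apply: atom_dmg_assocP => i.
  move=> ni; rewrite !ffunE /= ab; last by move/pfun_dom_assoc_filter.
  rewrite !term_subst_comp; apply: eq_in_term_subst => x xa; apply/esym/gN/QN.
  by exists (Atom a); [left|exists i].
move=> u tu; rewrite ffunE; apply: instance_of_subst.
by move: u tu; exact/assoc_filterP/ta.
Qed.

(** Here [rho] and [rho'] stand for the renamings of the clause in the given and the lifted step. *)
Lemma body_dmg (tau : positions_terms L) (c : clause L)
    (theta theta' rho rho' g : substitution L) :
  positions_DN_clause tau c ->
  (forall x, clause_vars c x ->
     (forall i, pfun_dom (tau (atom_rel (clause_head c))) i ->
        ~ term_vars (atom_args (clause_head c) i) x) ->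
     term_subst g (term_subst theta' (rho' x)) = term_subst theta (rho x)) ->
  query_dmg_for (assoc_filter tau) g
    (query_subst theta' (query_subst rho' (clause_body c)))
    (query_subst theta (query_subst rho (clause_body c))).
Proof.
case: c => H body [_ _ /= dn3 dn4] gE.
have : forall D, List.In D body -> atom_dmg (assoc_filter tau) g
    (atom_subst theta' (atom_subst rho' D)) (atom_subst theta (atom_subst rho D)).
  move=> [q d] Dbody; apply: atom_dmg_assocP => /= j.
    move=> nj; rewrite !ffunE !term_subst_comp; apply: eq_in_term_subst => x xd.
    rewrite -gE ?term_subst_comp //; first by right; exists (Atom d) => //; exists j.
    by move=> i ti hx; have /seteqP[/(_ x)[]] := dn3 _ ti _ Dbody _ nj.
  by move=> u tu; rewrite !ffunE; do 2!apply: instance_of_subst; exact: dn4 Dbody _ _ tu.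
elim: body {dn3 dn4 gE} => [|D body IH] HD; first by constructor.
constructor; first by apply: HD; left.
by apply: IH => D' D'b; apply: HD; right.
Qed.

Lemma filter_DN_clause_assoc (tau : positions_terms L) (c : clause L) :
  positions_DN_clause tau c -> filter_DN_clause (assoc_filter tau) c.
Proof.
move=> dn k Q Q1 step Q' QQ'; have [eta QQ] := QQ'.
have [theta [A [B [C [_ [[QE Ak] [r _ ->] _ [U _] Q1E]]]]]] := step.
have /List.Forall2_app_inv_r[A' [X [AA [XX Q'E]]]] :
  query_dmg_for (assoc_filter tau) eta Q' (A ++ B :: C) by rewrite -QE.
have [B' [C' [XE BB CC]]] : exists B' C', [/\ X = B' :: C',
    atom_dmg (assoc_filter tau) eta B' B & query_dmg_for (assoc_filter tau) eta C' C].
  by inversion XX as [|B' ? C' ? ? ?]; exists B', C'.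
rewrite {X XX}XE in Q'E.
have [N1 N1P] := clause_vars_bounded c; have [N2 N2P] := query_vars_bounded Q'.
(* Bounding both clause and lifted query by [N] makes the swapped clause variable disjoint from the
   query. *)
pose N := maxn N1 N2.
have cN x : clause_vars c x -> (x < N)%N by move/N1P => H; rewrite leq_max H.
have QN x : query_vars Q' x -> (x < N)%N by move/N2P => H; rewrite leq_max H orbT.
have [sigma [sQ sc sU]] : exists sigma : substitution L,
    [/\ forall x, (x < N)%N -> sigma x = term_subst theta (eta x),
        forall x, (x < N)%N ->
          (forall i, pfun_dom (tau (atom_rel (clause_head c))) i ->
             ~ term_vars (atom_args (clause_head c) i) x) ->
          sigma (x + N)%N = term_subst theta (r x)
      & unifier sigma B' (atom_subst (swap_subst N) (clause_head c))].
  case: (BB) => p [s [t [B'E BE _ _]]].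
  case: c dn cN U {step N1P Q1E} => -[q h] body dn cN U.
  (* Unifiability forces a common relation symbol, so both argument families get the same type. *)
  have pq : p = q by move: U; rewrite BE => -[].
  case: q / pq h dn cN U => h dn cN U.
  rewrite B'E; apply: (lift_unifier dn cN (t := t)).
  - move=> i x sx; apply: QN; exists B'; last by rewrite B'E; exists i.
    by rewrite Q'E; apply/List.in_or_app; right; left.
  - by rewrite -B'E -BE.
  - by rewrite -BE.
(* The factor [g] of [sigma] through [theta'] will relate the two resolvents. *)
have [theta' mgu'] := unifiable_mgu sU; have [g gP] := proj2 mgu' _ sU.
exists k, (query_subst theta' (A' ++ query_subst (swap_subst N) (clause_body c) ++ C')).
split=> //; first split=> //.
  exists theta', A', B', C', (clause_subst (swap_subst N) c); split=> //.
  - by split=> //; rewrite -Ak; exact: List.Forall2_length AA.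
  - by exists (swap_subst N) => //; exact: renaming_swap_subst.
  - rewrite -subset0 => y [/clause_vars_subst[x /cN xN /=]].
    by rewrite /swap_blocks xN => -> /QN; rewrite ltnNge leq_addl.
have gQ x : (x < N)%N -> term_subst g (theta' x) = term_subst theta (eta x).
  by move=> xN; rewrite -sQ // gP.
have dA : query_dmg_for (assoc_filter tau) g (query_subst theta' A') (query_subst theta A).
  apply: query_dmg_subst gQ AA => x [D DA xD]; apply: QN; exists D => //.
  by rewrite Q'E; apply/List.in_or_app; left.
have dC : query_dmg_for (assoc_filter tau) g (query_subst theta' C') (query_subst theta C).
  apply: query_dmg_subst gQ CC => x [D DC xD]; apply: QN; exists D => //.
  by rewrite Q'E; apply/List.in_or_app; right; right.
have dB : query_dmg_for (assoc_filter tau) g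
    (query_subst theta' (query_subst (swap_subst N) (clause_body c)))
    (query_subst theta (query_subst r (clause_body c))).
  apply: body_dmg => // x /cN xN nx.
  by rewrite /= /swap_blocks xN /= -sc // gP.
exists g; rewrite Q1E /query_subst !map_cat.
exact: List.Forall2_app dA (List.Forall2_app dB dC).
Qed.

End Lifting.

Theorem theorem5 (L : language) (P : program L) (tau : positions_terms L) :
  finite_set P -> positions_DN tau P -> filter_DN (assoc_filter tau) P.
Proof. by move=> _ dn c /dn; exact: filter_DN_clause_assoc. Qed.
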